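(* For each of the following sets $P=Q\cup\{r\}$ of five generalized patterns there is an integer $k$ such that $|S_n(P)|=2$ for every $n\ge k$. (a) $r=21\text{-}3$ and $Q$ one of: $\{1\text{-}23,2\text{-}13,x,y\}$ with $x\in\{1\text{-}32,13\text{-}2\}$, $y\in\{3\text{-}12,31\text{-}2\}$; $\{1\text{-}23,2\text{-}13,x,y\}$ with $x\in\{2\text{-}31,23\text{-}1\}$, $y\in\{1\text{-}32,13\text{-}2,3\text{-}12,31\text{-}2\}$; $\{12\text{-}3,2\text{-}13,x,32\text{-}1\}$ with $x\in\{2\text{-}31,23\text{-}1\}$; $\{2\text{-}13,2\text{-}31,1\text{-}32,3\text{-}12\}$, $\{2\text{-}13,2\text{-}31,1\text{-}32,31\text{-}2\}$, $\{2\text{-}13,2\text{-}31,13\text{-}2,31\text{-}2\}$; $\{2\text{-}13,23\text{-}1,x,y\}$ with $x\in\{1\text{-}32,13\text{-}2\}$, $y\in\{3\text{-}12,31\text{-}2\}$. (b) $r=3\text{-}12$ and $Q$ one of: $\{1\text{-}23,2\text{-}13,x,31\text{-}2\}$ with $x\in\{2\text{-}31,23\text{-}1,1\text{-}32,13\text{-}2\}$; $\{1\text{-}23,21\text{-}3,x,31\text{-}2\}$ with $x\in\{1\text{-}32,13\text{-}2\}$; $\{1\text{-}23,2\text{-}31,x,31\text{-}2\}$ with $x\in\{1\text{-}32,13\text{-}2\}$; $\{1\text{-}23,23\text{-}1,x,31\text{-}2\}$ with $x\in\{1\text{-}32,13\text{-}2\}$. (c) $r=23\text{-}1$ and $Q$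 one of: $\{2\text{-}13,2\text{-}31,1\text{-}32,31\text{-}2\}$; $\{1\text{-}23,2\text{-}31,x,y\}$ with $x\in\{1\text{-}32,13\text{-}2\}$, $y\in\{3\text{-}12,31\text{-}2\}$; $\{1\text{-}23,21\text{-}3,2\text{-}31,x\}$ with $x\in\{1\text{-}32,13\text{-}2,3\text{-}12,31\text{-}2\}$; $\{1\text{-}23,2\text{-}13,2\text{-}31,x\}$ with $x\in\{1\text{-}32,13\text{-}2,3\text{-}12,31\text{-}2\}$. (d) $r=1\text{-}32$ and $Q$ one of: $\{1\text{-}23,2\text{-}13,x,13\text{-}2\}$ with $x\in\{2\text{-}31,23\text{-}1,3\text{-}12,31\text{-}2\}$; $\{1\text{-}23,21\text{-}3,x,13\text{-}2\}$ with $x\in\{2\text{-}31,23\text{-}1,3\text{-}12,31\text{-}2\}$; $\{1\text{-}23,2\text{-}31,13\text{-}2,x\}$ with $x\in\{3\text{-}12,31\text{-}2\}$; $\{1\text{-}23,23\text{-}1,13\text{-}2,x\}$ with $x\in\{3\text{-}12,31\text{-}2\}$. (e) $r=12\text{-}3$ and $Q$ one of: $\{1\text{-}23,2\text{-}13,x,y\}$ with $x\in\{2\text{-}31,23\text{-}1\}$, $y\in\{1\text{-}32,13\text{-}2,3\text{-}12,31\text{-}2\}$; $\{1\text{-}23,2\text{-}13,1\text{-}32,x\}$ with $x\in\{3\text{-}12,31\text{-}2\}$; $\{1\text{-}23,21\text{-}3,x,y\}$ with $x\in\{2\text{-}31,23\text{-}1\}$, $y\in\{1\text{-}32,3\tex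t{-}12,31\text{-}2\}$.
   Context: $S_n$ is the set of permutations $\pi=\pi_1\pi_2\cdots\pi_n$ of $\{1,\dots,n\}$. For $abc$ a permutation of $123$, the generalized pattern $a\text{-}bc$ is contained in $\pi$ if there are indices $i<j$ with $j+1\le n$ such that $\pi_i\pi_j\pi_{j+1}$ is order-isomorphic to $abc$; the generalized pattern $ab\text{-}c$ is contained in $\pi$ if there are indices $i,k$ with $i+1<k\le n$ such that $\pi_i\pi_{i+1}\pi_k$ is order-isomorphic to $abc$. (Letters not separated by a dash must occur in adjacent positions; letters separated by a dash need not be adjacent.) $\pi$ avoids a pattern if it does not contain it. For a set $P$ of generalized patterns, $S_n(P)$ is the set of $\pi\in S_n$ avoiding every pattern in $P$. *)

(* Defs.v *)
From mathcomp Require Import all_boot all_fingroup.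

Set Implicit Arguments.
Unset Strict Implicit.
Unset Printing Implicit Defensive.

(* A permutation of {1, ..., n} is an s : 'S_n, i.e. a permutation of
   {0, ..., n - 1}: positions and values are shifted down by one, which does not
   affect order-isomorphism. The letters 1, 2, 3 of a pattern are likewise
   0, 1, 2 : 'I_3. *)

Definition word123 : finType := {w : 3.-tuple 'I_3 | uniq w}.

(* (true, abc) is the pattern a-bc and (false, abc) is the pattern ab-c. *)
Definition gpattern : finType := (bool * word123)%type.

Definition order_iso (k m n : nat) (u : k.-tuple 'I_m) (v : k.-tuple 'I_n) :
    bool :=
  [forall s : 'I_k, forall t : 'I_k,
     (tnth u s < tnth u t) == (tnth v s < tnth v t)].

Definition contains (n : nat) (s : 'S_n) (p : gpattern) : bool :=
  let: (dash_first, abc) := p in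
  if dash_first then
    [exists i : 'I_n, exists j : 'I_n, exists j' : 'I_n,
       [&& i < j, j' == j.+1 :> nat
         & order_iso [tuple s i; s j; s j'] (val abc)]]
  else
    [exists i : 'I_n, exists i' : 'I_n, exists k : 'I_n,
       [&& i' == i.+1 :> nat, i' < k
         & order_iso [tuple s i; s i'; s k] (val abc)]].

Definition Avoiders (n : nat) (P : {set gpattern}) : {set 'S_n} :=
  [set s : 'S_n | [forall p in P, ~~ contains s p]].

Definition l1 : 'I_3 := @Ordinal 3 0 isT.
Definition l2 : 'I_3 := @Ordinal 3 1 isT.
Definition l3 : 'I_3 := @Ordinal 3 2 isT.

Definition w123 : word123 := exist _ [tuple l1; l2; l3] isT.
Definition w132 : word123 := exist _ [tuple l1; l3; l2] isT.
Definition w213 : word123 := exist _ [tuple l2; l1; l3] isT.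
Definition w231 : word123 := exist _ [tuple l2; l3; l1] isT.
Definition w312 : word123 := exist _ [tuple l3; l1; l2] isT.
Definition w321 : word123 := exist _ [tuple l3; l2; l1] isT.

Definition p1_23 : gpattern := (true, w123).
Definition p12_3 : gpattern := (false, w123).
Definition p1_32 : gpattern := (true, w132).
Definition p13_2 : gpattern := (false, w132).
Definition p2_13 : gpattern := (true, w213).
Definition p21_3 : gpattern := (false, w213).
Definition p2_31 : gpattern := (true, w231).
Definition p23_1 : gpattern := (false, w231).
Definition p3_12 : gpattern := (true, w312).
Definition p31_2 : gpattern := (false, w312).
Definition p32_1 : gpattern := (false, w321).

(* The sets Q to which 21-3, 3-12, 23-1, 1-32 and 12-3, respectively, is
   added. *)

Definition Qs_21_3 : {set {set gpattern}} :=
  [set [set p1_23; p2_13; x; y]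
     | x in [set p1_32; p13_2], y in [set p3_12; p31_2]]
  :|: [set [set p1_23; p2_13; x; y]
     | x in [set p2_31; p23_1], y in [set p1_32; p13_2; p3_12; p31_2]]
  :|: [set [set p12_3; p2_13; x; p32_1] | x in [set p2_31; p23_1]]
  :|: [set [set p2_13; p2_31; p1_32; p3_12];
           [set p2_13; p2_31; p1_32; p31_2];
           [set p2_13; p2_31; p13_2; p31_2]]
  :|: [set [set p2_13; p23_1; x; y]
     | x in [set p1_32; p13_2], y in [set p3_12; p31_2]].

Definition Qs_3_12 : {set {set gpattern}} :=
  [set [set p1_23; p2_13; x; p31_2] | x in [set p2_31; p23_1; p1_32; p13_2]]
  :|: [set [set p1_23; p21_3; x; p31_2] | x in [set p1_32; p13_2]]
  :|: [set [set p1_23; p2_31; x; p31_2] | x in [set p1_32; p13_2]]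
  :|: [set [set p1_23; p23_1; x; p31_2] | x in [set p1_32; p13_2]].

Definition Qs_23_1 : {set {set gpattern}} :=
  [set [set p2_13; p2_31; p1_32; p31_2]]
  :|: [set [set p1_23; p2_31; x; y]
     | x in [set p1_32; p13_2], y in [set p3_12; p31_2]]
  :|: [set [set p1_23; p21_3; p2_31; x]
     | x in [set p1_32; p13_2; p3_12; p31_2]]
  :|: [set [set p1_23; p2_13; p2_31; x]
     | x in [set p1_32; p13_2; p3_12; p31_2]].

Definition Qs_1_32 : {set {set gpattern}} :=
  [set [set p1_23; p2_13; x; p13_2] | x in [set p2_31; p23_1; p3_12; p31_2]]
  :|: [set [set p1_23; p21_3; x; p13_2]
     | x in [set p2_31; p23_1; p3_12; p31_2]]
  :|: [set [set p1_23; p2_31; p13_2; x] | x in [set p3_12; p31_2]]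
  :|: [set [set p1_23; p23_1; p13_2; x] | x in [set p3_12; p31_2]].

Definition Qs_12_3 : {set {set gpattern}} :=
  [set [set p1_23; p2_13; x; y]
     | x in [set p2_31; p23_1], y in [set p1_32; p13_2; p3_12; p31_2]]
  :|: [set [set p1_23; p2_13; p1_32; x] | x in [set p3_12; p31_2]]
  :|: [set [set p1_23; p21_3; x; y]
     | x in [set p2_31; p23_1], y in [set p1_32; p3_12; p31_2]].

(* Main.v *)
Require Import Defs.
From mathcomp Require Import all_boot all_fingroup.
From mathcomp Require Import zify.

(* A sequence is determined, up to order-isomorphism, by its shape: the truth
   value of [f i < f j] for [i < j].  By a discrete intermediate value argument
   2-13 forbids 21-3, 13-2 forbids 1-32, 2-31 forbids 23-1 and 31-2 forbids
   3-12.  All but two of the sets P thus forbid four of 1-23, 1-32, 21-3, 23-1,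
   3-12, and all their patterns have the same four underlying words; the four
   constraints leave only the decreasing shape and one other.  The two remaining
   sets forbid 12-3, 21-3, 23-1 and 32-1, which forces every later letter to lie
   between any two adjacent ones; this leaves the two zigzags 1 n 2 n-1 ... and
   n 1 n-1 2 ... *)

Set Implicit Arguments.
Unset Strict Implicit.
Unset Printing Implicit Defensive.

(* On pairwise distinct [x], [y], [z] this is order-isomorphism to [w]; with ties,
   [x < y] being false counts as [y < x]. *)
Definition agree (x y z : nat) (w : word123) : bool :=
  [&& (x < y) == (tnth (val w) l1 < tnth (val w) l2),
      (x < z) == (tnth (val w) l1 < tnth (val w) l3)
    & (y < z) == (tnth (val w) l2 < tnth (val w) l3)].

Lemma agree123 x y z : agree x y z w123 = (x < y < z).
Proof. by rewrite /agree /tnth /=; lia. Qed.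
Lemma agree132 x y z : agree x y z w132 = (x < z <= y).
Proof. by rewrite /agree /tnth /=; lia. Qed.
Lemma agree213 x y z : agree x y z w213 = (y <= x < z).
Proof. by rewrite /agree /tnth /=; lia. Qed.
Lemma agree231 x y z : agree x y z w231 = (z <= x < y).
Proof. by rewrite /agree /tnth /=; lia. Qed.
Lemma agree312 x y z : agree x y z w312 = (y < z <= x).
Proof. by rewrite /agree /tnth /=; lia. Qed.
Lemma agree321 x y z : agree x y z w321 = (z <= y <= x).
Proof. by rewrite /agree /tnth /=; lia. Qed.

Definition agreeE := (agree123, agree132, agree213, agree231, agree312, agree321).

Lemma forall_ord3 (P : pred 'I_3) : [forall i, P i] = [&& P l1, P l2 & P l3].
Proof.
apply/forallP/and3P => [PP | [P1 P2 P3] [[|[|[|k]]] lt_k3]] //.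
- by rewrite (_ : Ordinal lt_k3 = l1) //; apply: val_inj.
- by rewrite (_ : Ordinal lt_k3 = l2) //; apply: val_inj.
- by rewrite (_ : Ordinal lt_k3 = l3) //; apply: val_inj.
Qed.

(** [order_iso] compares all nine pairs of indices. The diagonal pairs are trivial, and distinctness
    on both sides turns a reversed comparison into a negation, so three pairs decide. *)
Lemma order_iso_agree n (x y z : 'I_n) (w : word123) :
  uniq [:: x; y; z] -> order_iso [tuple x; y; z] (val w) = agree x y z w.
Proof.
move=> uniq_xyz; rewrite /order_iso !forall_ord3.
have := valP w.
rewrite /agree (_ : uniq (val w) =
    uniq [seq tnth (val w) i | i <- [:: l1; l2; l3]]); last first.
  by congr uniq; case: (val w) => [[|a [|b [|c [|d u]]]]].
rewrite /= !inE -!val_eqE /= in uniq_xyz *.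
by rewrite /tnth /=; lia.
Qed.

(** A total function on [nat] keeps arithmetic on positions free of bound proofs. Past [m] the
    default of [inord] gives the junk value [s ord0], so later statements bound their indices by
    [m]. *)
Definition letter m (s : 'S_m.+1) (i : nat) : nat := s (inord i).

Lemma letter_ord m (s : 'S_m.+1) (i : 'I_m.+1) : letter s i = s i.
Proof. by rewrite /letter inord_val. Qed.

Definition distinct_letters m (f : nat -> nat) : Prop :=
  forall i j, i < j -> j <= m -> f i <> f j.

Lemma letter_inj m (s : 'S_m.+1) : distinct_letters m (letter s).
Proof.
move=> i j lt_ij le_jm /val_inj /perm_inj /(congr1 (@nat_of_ord _)).
by rewrite !inordK; lia.
Qed.

(** One increasing triple serves both kinds of pattern: the flag [p.1] says which two positions must
    be adjacent. The bound [m] is the last index, not the length. *)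
Definition avoids m (f : nat -> nat) (p : gpattern) : Prop :=
  forall i j k, i < j -> j < k -> k <= m ->
    k = j.+1 /\ p.1 \/ j = i.+1 /\ ~~ p.1 -> ~~ agree (f i) (f j) (f k) p.2.

Lemma avoidsP m (s : 'S_m.+1) (p : gpattern) :
  reflect (avoids m (letter s) p) (~~ contains s p).
Proof.
have uniq_s (i j k : 'I_m.+1) : i < j -> j < k -> uniq [:: s i; s j; s k].
  move=> lt_ij lt_jk; rewrite /= !inE !(inj_eq perm_inj) -!val_eqE /=; lia.
apply: (iffP idP) => [|av].
  move=> + i j k lt_ij lt_jk le_km adj; apply: contra => ag.
  have [oi oj ok] : [/\ i < m.+1, j < m.+1 & k < m.+1] by split; lia.
  have iso : order_iso [tuple s (Ordinal oi); s (Ordinal oj); s (Ordinal ok)]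
               (val p.2).
    by rewrite order_iso_agree -?letter_ord // uniq_s.
  case: p adj ag iso => [[] w] /= adj ag iso;
    apply/existsP; exists (Ordinal oi); apply/existsP; exists (Ordinal oj);
    apply/existsP; exists (Ordinal ok); rewrite iso /=; lia.
apply/negP; case: p av => [[] w] /= av;
  case/existsP=> i /existsP[j] /existsP[k] /and3P[/= ij jk];
  rewrite order_iso_agree ?uniq_s -?letter_ord; try lia;
  by apply/negP/av => /=; have := ltn_ord k; lia.
Qed.

(** * Moving the dash by a discrete intermediate value argument *)

Lemma last_index_before_drop (P : pred nat) a b :
  a <= b -> P a -> ~~ P b -> exists l, [/\ a <= l, l < b, P l & ~~ P l.+1].
Proof.
move=> le_ab; rewrite -(subnKC le_ab); elim: (b - a) => [|d IHd] Pa.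
  by rewrite addn0 Pa.
rewrite addnS; case: (boolP (P (a + d))) => [Pd nPd | nPd _].
  by exists (a + d); split=> //; lia.
by have [l [? ? ? ?]] := IHd Pa nPd; exists l; split=> //; lia.
Qed.

Section Strengthen.
Variables (m : nat) (f : nat -> nat).

(** In this lemma and the next three, the letter 2 stands outside the stretch between 1 and 3. Along
    that stretch the sequence crosses the level of 2 between two neighbours, which then act as
    adjacent letters 1 and 3. *)
Lemma avoids132 : avoids m f p13_2 -> avoids m f p1_32.
Proof.
move=> av i j k ij jk km /= adj; rewrite agreeE; apply/negP=> fijk.
have [||| l [il lj Pl Nl]] :=
  @last_index_before_drop [pred l | f l < f k] i j => /=; try lia.
have := av l l.+1 k; rewrite /= agreeE; move: Pl Nl => /=; lia.
Qed.

Lemma avoids213 : avoids m f p2_13 -> avoids m f p21_3.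
Proof.
move=> av i j k ij jk km /= adj; rewrite agreeE; apply/negP=> fijk.
have [||| l [il lj Pl Nl]] :=
  @last_index_before_drop [pred l | f l <= f i] j k => /=; try lia.
have := av i l l.+1; rewrite /= agreeE; move: Pl Nl => /=; lia.
Qed.

Lemma avoids231 : avoids m f p2_31 -> avoids m f p23_1.
Proof.
move=> av i j k ij jk km /= adj; rewrite agreeE; apply/negP=> fijk.
have [||| l [il lj Pl Nl]] :=
  @last_index_before_drop [pred l | f i < f l] j k => /=; try lia.
have := av i l l.+1; rewrite /= agreeE; move: Pl Nl => /=; lia.
Qed.

Lemma avoids312 : avoids m f p31_2 -> avoids m f p3_12.
Proof.
move=> av i j k ij jk km /= adj; rewrite agreeE; apply/negP=> fijk.
have [||| l [il lj Pl Nl]] :=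
  @last_index_before_drop [pred l | f k <= f l] i j => /=; try lia.
have := av l l.+1 k; rewrite /= agreeE; move: Pl Nl => /=; lia.
Qed.

End Strengthen.

(** * Shapes and the permutations that realize them *)

Definition shape m (f : nat -> nat) (c : rel nat) : Prop :=
  forall i j, i < j -> j <= m -> (f i < f j) = c i j.

(** The value at a position is the number of positions with smaller values, and the shape settles
    all these comparisons. *)
Lemma shape_inj m (c : rel nat) (s t : 'S_m.+1) :
  shape m (letter s) c -> shape m (letter t) c -> s = t.
Proof.
move=> sc tc.
have mono (i j : 'I_m.+1) : (s i < s j) = (t i < t j).
  have [ij|ji|/val_inj ->] := ltngtP i j; last by rewrite !ltnn.
    by rewrite -!letter_ord sc ?tc // -ltnS.
  have := @sc j i ji; have := @tc j i ji; rewrite !letter_ord -ltnS ltn_ord.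
  move=> /(_ isT) tji /(_ isT) sji.
  have := inj_eq (@perm_inj _ s) i j; have := inj_eq (@perm_inj _ t) i j.
  rewrite -!val_eqE /=; lia.
have rank (u : 'S_m.+1) i : #|[set j | u j < u i]| = u i.
  rewrite -(card_imset _ (@perm_inj _ u)) (_ : _ @: _ = [set k : 'I_m.+1 | k < u i]).
    by rewrite -sum1dep_card (big_ord_narrow (ltnW (ltn_ord (u i)))) sum1_card card_ord.
  apply/setP=> k; rewrite inE -{1}(permKV u k) mem_imset ?inE ?permKV //.
  exact: perm_inj.
apply/permP => i; apply: val_inj => /=.
by rewrite -[LHS]rank -[RHS]rank; congr #|pred_of_set _|;
  apply/setP=> j; rewrite !inE mono.
Qed.

(* The usual characterization of inversion sets: they and their complements are
   transitive. *)
Definition consistent m (c : rel nat) : Prop :=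
  forall i j k, i < j -> j < k -> k <= m -> c i j = c j k -> c i k = c i j.

(** [before] extends [c] to a strict total order on positions; mapping each position to its number
    of predecessors gives the permutation. *)
Lemma shape_realizable m (c : rel nat) :
  consistent m c -> exists s : 'S_m.+1, shape m (letter s) c.
Proof.
move=> cc; pose before (i j : 'I_m.+1) := if i < j then c i j else (j < i) && ~~ c j i.
have beforexx i : before i i = false by rewrite /before ltnn.
have before_total i j : i != j -> before i j = ~~ before j i.
  rewrite -val_eqE /before /=; case: ltngtP => //=; by rewrite negbK.
have before_trans j i k : before i j -> before j k -> before i k.
  have [/val_inj -> //|ne_ij] := eqVneq (i : nat) j.
  have [/val_inj -> //|ne_jk] := eqVneq (j : nat) k.
  have [/val_inj -> |ne_ik] := eqVneq (i : nat) k.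
    by move=> kj; rewrite before_total ?kj // -val_eqE.
  have := ltn_ord i; have := ltn_ord j; have := ltn_ord k.
  (* One instance of consistency for each relative order of the three positions. *)
  have := cc i j k; have := cc i k j; have := cc j i k.
  have := cc j k i; have := cc k i j; have := cc k j i.
  rewrite /before; move: ne_ij ne_jk ne_ik.
  case: (ltngtP i j) => // ij _; case: (ltngtP j k) => // jk _;
  case: (ltngtP i k) => // ik _ /=; lia.
pose rank i := #|[set j | before j i]|.
have rank_lt i j : before i j -> rank i < rank j.
  move=> ij; apply/proper_card/properP; split.
    by apply/subsetP=> k; rewrite !inE => /before_trans; apply.
  by exists i; rewrite !inE ?beforexx.
have rank_bound i : rank i < m.+1.
  rewrite -[X in _ < X]card_ord -cardsT; apply/proper_card/properP.
  by split; [apply: subsetT | exists i; rewrite !inE ?beforexx].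
have rank_inj : injective (fun i => Ordinal (rank_bound i)).
  move=> i j /(congr1 val) /= eq_r; apply/eqP/negPn/negP => ne_ij.
  have [ij|] := boolP (before i j); first by have := rank_lt _ _ ij; rewrite eq_r ltnn.
  by rewrite -before_total 1?eq_sym // => /rank_lt; rewrite eq_r ltnn.
exists (perm rank_inj) => i j lt_ij le_jm.
have [oi oj] : i < m.+1 /\ j < m.+1 by lia.
rewrite (letter_ord _ (Ordinal oi)) (letter_ord _ (Ordinal oj)) !permE /=.
have ne_ij : Ordinal oi != Ordinal oj by rewrite -val_eqE /=; lia.
have bij : before (Ordinal oi) (Ordinal oj) = c i j by rewrite /before /= lt_ij.
rewrite -bij; case bE: (before _ _); first exact: rank_lt.
by apply/negbTE; rewrite -leqNgt ltnW // rank_lt // before_total ?bE // eq_sym.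
Qed.

(** Consistency supplies one permutation per shape, [shape_inj] leaves no further one, and the pair
    [i], [j] tells the two apart. *)
Lemma card_Avoiders2 m (P : {set gpattern}) (c d : rel nat) (i j : nat) :
    consistent m c -> consistent m d -> i < j -> j <= m -> c i j <> d i j ->
    (forall s : 'S_m.+1,
       shape m (letter s) c \/ shape m (letter s) d <->
       (forall p, p \in P -> avoids m (letter s) p)) ->
  #|Avoiders m.+1 P| = 2.
Proof.
move=> /shape_realizable[s sc] /shape_realizable[t td] ij jm ne_cd av.
rewrite (_ : Avoiders _ _ = [set s; t]) ?cards2; last first.
  apply/setP=> u; rewrite !inE; apply/forall_inP/orP => [avu | eq_u].
    have [|uc|ud] := (av u).2; first by move=> p /avu /avoidsP.
      by left; apply/eqP/(shape_inj uc).
    by right; apply/eqP/(shape_inj ud).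
  move=> p pP; apply/avoidsP; apply: (av u).1 p pP.
  by case: eq_u => /eqP->; [left | right].
by case: eqP => // st; case: ne_cd; rewrite -(sc i j) // -(td i j) // st.
Qed.

(* With n = m + 1, [shape_swap] is n-1 n n-2 ... 1, [shape_swap_last] is
   n ... 3 1 2, [shape_min_first] is 1 n ... 2, [shape_max_last] is n-1 ... 1 n,
   and [shape_zigzag false] is 1 n 2 n-1 ... *)
Definition shape_dec : rel nat := fun _ _ => false.
Definition shape_inc : rel nat := fun _ _ => true.
Definition shape_swap : rel nat := fun i j => (i == 0) && (j == 1).
Definition shape_swap_last m : rel nat := fun i _ => i.+1 == m.
Definition shape_min_first : rel nat := fun i _ => i == 0.
Definition shape_max_last m : rel nat := fun _ j => j == m.
Definition shape_zigzag (b : bool) : rel nat := fun i _ => odd i == b.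

Lemma shape_dec_consistent m : consistent m shape_dec.
Proof. by rewrite /consistent /shape_dec; lia. Qed.

Lemma shape_inc_consistent m : consistent m shape_inc.
Proof. by rewrite /consistent /shape_inc; lia. Qed.

Lemma shape_swap_consistent m : consistent m shape_swap.
Proof. by rewrite /consistent /shape_swap; lia. Qed.

Lemma shape_min_first_consistent m : consistent m shape_min_first.
Proof. by rewrite /consistent /shape_min_first; lia. Qed.

Lemma shape_swap_last_consistent m : consistent m (shape_swap_last m).
Proof. by rewrite /consistent /shape_swap_last; lia. Qed.

Lemma shape_max_last_consistent m : consistent m (shape_max_last m).
Proof. by rewrite /consistent /shape_max_last; lia. Qed.

Lemma shape_zigzag_consistent m b : consistent m (shape_zigzag b).
Proof. by rewrite /consistent /shape_zigzag; lia. Qed.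

Lemma descents_decreasing (f : nat -> nat) a m :
    (forall i, a <= i -> i < m -> f i.+1 < f i) ->
  forall i j, a <= i -> i < j -> j <= m -> f j < f i.
Proof.
move=> desc i j le_ai; elim: j => // j IHj; rewrite ltnS leq_eqVlt.
case/predU1P => [<- | lt_ij] le_jm; first exact: desc.
by apply: ltn_trans (desc j _ _) (IHj _ _) => //; lia.
Qed.

(** * The special shapes: what they avoid and which patterns force them *)

Section Shapes.
Variables (m : nat) (f : nat -> nat).
Hypothesis f_inj : distinct_letters m f.

Let f_neq i j : i < j -> j <= m -> f i != f j.
Proof. by move=> ij jm; apply/eqP/f_inj. Qed.

(** Triples of the decreasing shape have word 321. Besides it, [shape_swap] admits only 231,
    [shape_swap_last] 312, [shape_min_first] 132 and [shape_max_last] 213; [shape_inc] has only 123.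
    Each list omits these words and 321, so the dash never matters. *)
Lemma shape_dec_avoids p :
    shape m f shape_dec -> p.2 \in [:: w123; w132; w213; w231; w312] -> avoids m f p.
Proof.
move=> fc; rewrite !inE => pw i j k ij jk km _.
have := fc i j; have := fc i k; have := fc j k.
by rewrite /shape_dec; case/or4P: pw => [|||/orP[]] /eqP->; rewrite agreeE; lia.
Qed.

Lemma shape_swap_avoids p :
    shape m f shape_swap -> p.2 \in [:: w123; w132; w213; w312] -> avoids m f p.
Proof.
move=> fc; rewrite !inE => pw i j k ij jk km _.
have := fc i j; have := fc i k; have := fc j k.
by rewrite /shape_swap; case/or4P: pw => /eqP->; rewrite agreeE; lia.
Qed.

Lemma shape_swap_last_avoids p :
    shape m f (shape_swap_last m) -> p.2 \in [:: w123; w132; w213; w231] -> avoids m f p.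
Proof.
move=> fc; rewrite !inE => pw i j k ij jk km _.
have := fc i j; have := fc i k; have := fc j k.
by rewrite /shape_swap_last; case/or4P: pw => /eqP->; rewrite agreeE; lia.
Qed.

Lemma shape_min_first_avoids p :
    shape m f shape_min_first -> p.2 \in [:: w123; w213; w231; w312] -> avoids m f p.
Proof.
move=> fc; rewrite !inE => pw i j k ij jk km _.
have := fc i j; have := fc i k; have := fc j k.
by rewrite /shape_min_first; case/or4P: pw => /eqP->; rewrite agreeE; lia.
Qed.

Lemma shape_max_last_avoids p :
    shape m f (shape_max_last m) -> p.2 \in [:: w123; w132; w231; w312] -> avoids m f p.
Proof.
move=> fc; rewrite !inE => pw i j k ij jk km _.
have := fc i j; have := fc i k; have := fc j k.
by rewrite /shape_max_last; case/or4P: pw => /eqP->; rewrite agreeE; lia.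
Qed.

Lemma shape_inc_avoids p :
    shape m f shape_inc -> p.2 \in [:: w132; w213; w231; w312] -> avoids m f p.
Proof.
move=> fc; rewrite !inE => pw i j k ij jk km _.
have := fc i j; have := fc i k; have := fc j k.
by rewrite /shape_inc; case/or4P: pw => /eqP->; rewrite agreeE; lia.
Qed.

(** The first letter of any triple is its minimum or maximum, which excludes 213 and 231. Adjacent
    positions have opposite parity, which excludes 12-3 and 32-1. *)
Lemma shape_zigzag_avoids b p :
    shape m f (shape_zigzag b) ->
    p \in [:: p12_3; p2_13; p21_3; p2_31; p23_1; p32_1] -> avoids m f p.
Proof.
move=> fc; rewrite !inE => pw i j k ij jk km adj.
have := fc i j; have := fc i k; have := fc j k; rewrite /shape_zigzag.
case/or4P: pw adj => [/eqP->|/eqP->|/eqP->|/or3P[]/eqP->] /= adj; rewrite agreeE; lia.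
Qed.

Lemma shape_swap_forced :
    avoids m f p1_23 -> avoids m f p1_32 -> avoids m f p21_3 -> avoids m f p3_12 ->
  shape m f shape_dec \/ shape m f shape_swap.
Proof.
move=> av123 av132 av213 av312.
(* An ascent past the first position forms 123, 213 or 312 with the letter just before it. *)
have desc i : 1 <= i -> i < m -> f i.+1 < f i.
  case: i => // i _ im; rewrite ltnNge; apply/negP=> fi.
  have := av123 i i.+1 i.+2; have := av132 i i.+1 i.+2.
  have := av213 i i.+1 i.+2; have := av312 i i.+1 i.+2.
  have := @f_neq i i.+1; have := @f_neq i i.+2; have := @f_neq i.+1 i.+2.
  rewrite /= !agreeE; lia.
have dec := descents_decreasing desc.
have [f01|f10] := ltnP (f 0) (f 1); [right | left] => i j ij jm;
  rewrite /shape_swap /shape_dec.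
  have [i0|i0] := posnP i; last by have := dec i j i0 ij jm; lia.
  have [j2|j1] := ltnP 1 j; last by have -> : j = 1 by [lia]; rewrite i0 f01.
  (* After an initial ascent the third letter must fall below the first, and all later letters lie
     lower still. *)
  have := av123 0 1 2; have := av132 0 1 2; rewrite /= !agreeE; subst i.
  by have := dec 2 j; have [j2e|j3] := eqVneq j 2; try subst j; lia.
have := dec i j; have := dec 1 j; have := @f_neq 0 1.
have [i0|i0] := posnP i; last by lia.
by subst i; have [j1|j1] := eqVneq j 1; try subst j; lia.
Qed.

Lemma shape_swap_last_forced :
    avoids m f p1_23 -> avoids m f p1_32 -> avoids m f p21_3 -> avoids m f p23_1 ->
  shape m f shape_dec \/ shape m f (shape_swap_last m).
Proof.
move=> av123 av132 av213 av231.
(* An ascent followed by another letter forms 123, 132 or 231 with it, so only the last step can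
   ascend. *)
have desc i : 0 <= i -> i < m.-1 -> f i.+1 < f i.
  move=> _ im; rewrite ltnNge; apply/negP=> fi.
  have := av123 i i.+1 i.+2; have := av132 i i.+1 i.+2; have := av231 i i.+1 i.+2.
  have := @f_neq i i.+1; have := @f_neq i i.+2; have := @f_neq i.+1 i.+2.
  rewrite /= !agreeE; lia.
have dec := descents_decreasing desc.
(* Position [i] starts a descent, so by 21-3 the last letter cannot exceed letter [i]. *)
have low i : i.+1 < m -> f m < f i.
  move=> im; have := av213 i i.+1 m; have := desc i; have := @f_neq i m.
  rewrite /= !agreeE; lia.
have [fm|fm] := ltnP (f m.-1) (f m); [right | left] => i j ij jm;
  rewrite /shape_swap_last /shape_dec; have := dec i j;
  have [jE|ne_j] := eqVneq j m; try lia.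
- have [->|ne_i] := eqVneq i m.-1; first by rewrite jE fm; lia.
  by have := low i; rewrite jE; lia.
- have [->|ne_i] := eqVneq i m.-1; first by rewrite jE; lia.
  by have := low i; rewrite jE; lia.
Qed.

Lemma shape_min_first_forced :
    avoids m f p1_23 -> avoids m f p21_3 -> avoids m f p23_1 -> avoids m f p3_12 ->
  shape m f shape_dec \/ shape m f shape_min_first.
Proof.
move=> av123 av213 av231 av312.
have desc i : 1 <= i -> i < m -> f i.+1 < f i.
  case: i => // i _ im; rewrite ltnNge; apply/negP=> fi.
  have := av123 i i.+1 i.+2; have := av312 i i.+1 i.+2; have := av213 i i.+1 i.+2.
  have := @f_neq i i.+1; have := @f_neq i i.+2; have := @f_neq i.+1 i.+2.
  rewrite /= !agreeE; lia.
have dec := descents_decreasing desc.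
have [f01|f10] := ltnP (f 0) (f 1); [right | left] => i j ij jm;
  rewrite /shape_min_first /shape_dec.
  have [i0|i0] := posnP i; last by have := dec i j i0 ij jm; lia.
  (* After an initial ascent, 23-1 keeps every later letter above the first. *)
  have := av231 0 1 j; have := @f_neq 0 j; rewrite /= !agreeE; subst i.
  by have [j1|j1] := eqVneq j 1; try subst j; lia.
have := dec i j; have := dec 1 j; have := @f_neq 0 1.
have [i0|i0] := posnP i; last by lia.
by subst i; have [j1|j1] := eqVneq j 1; try subst j; lia.
Qed.

Lemma shape_max_last_forced :
    avoids m f p1_23 -> avoids m f p1_32 -> avoids m f p23_1 -> avoids m f p3_12 ->
  shape m f shape_dec \/ shape m f (shape_max_last m).
Proof.
move=> av123 av132 av231 av312.
have desc i : 0 <= i -> i < m.-1 -> f i.+1 < f i.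
  move=> _ im; rewrite ltnNge; apply/negP=> fi.
  have := av123 i i.+1 i.+2; have := av132 i i.+1 i.+2; have := av231 i i.+1 i.+2.
  have := @f_neq i i.+1; have := @f_neq i i.+2; have := @f_neq i.+1 i.+2.
  rewrite /= !agreeE; lia.
have dec := descents_decreasing desc.
have [fm|fm] := ltnP (f m.-1) (f m); [right | left] => i j ij jm;
  rewrite /shape_max_last /shape_dec; have := dec i j;
  have [jE|ne_j] := eqVneq j m; try lia;
  (* If the last step ascends, 3-12 on [i], [m.-1], [m] puts the last letter above letter [i]. *)
  have [->|ne_i] := eqVneq i m.-1; try lia; rewrite jE; have := dec i m.-1;
  have := @f_neq i m; have := @f_neq m.-1 m; have := av312 i m.-1 m;
  rewrite /= !agreeE; lia.
Qed.

Lemma shape_inc_forced :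
    avoids m f p1_32 -> avoids m f p21_3 -> avoids m f p23_1 -> avoids m f p3_12 ->
  shape m f shape_dec \/ shape m f shape_inc.
Proof.
move=> av132 av213 av231 av312.
(* A turn upwards is 213 or 312 and a turn downwards is 132 or 231, so the direction never
   changes. *)
have same i : i.+1 < m -> (f i < f i.+1) = (f i.+1 < f i.+2).
  move=> im; have := av132 i i.+1 i.+2; have := av213 i i.+1 i.+2.
  have := av231 i i.+1 i.+2; have := av312 i i.+1 i.+2.
  have := @f_neq i i.+1; have := @f_neq i i.+2; have := @f_neq i.+1 i.+2.
  rewrite /= !agreeE; lia.
have all01 i : i < m -> (f i < f i.+1) = (f 0 < f 1).
  by elim: i => // i IHi im; rewrite -same // IHi //; lia.
case f01: (f 0 < f 1); [right | left] => i j ij jm; rewrite /shape_inc /shape_dec.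
  elim: j ij jm => // j IHj; rewrite ltnS leq_eqVlt.
  case/predU1P=> [-> | ij] jm; have := all01 j jm; first by rewrite f01.
  have := IHj ij; lia.
apply/negbTE; rewrite -leqNgt ltnW //; apply: (@descents_decreasing f 0 m) => // k _ km.
by have := all01 k km; have := @f_neq k k.+1; lia.
Qed.

Lemma shape_zigzag_forced :
    avoids m f p12_3 -> avoids m f p21_3 -> avoids m f p23_1 -> avoids m f p32_1 ->
  shape m f (shape_zigzag true) \/ shape m f (shape_zigzag false).
Proof.
move=> av123 av213 av231 av321.
(* Letter [k] lies strictly between letters [i] and [i.+1]. With [k = i.+2] this reverses the
   direction at each step; for general [k] it reduces a comparison with letter [i] to the adjacent
   one. *)
have between i k : i.+1 < k -> k <= m ->
    (f i < f k) = (f i < f i.+1) /\ (f i.+1 < f k) = ~~ (f i < f i.+1).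
  move=> ik km; have := av123 i i.+1 k; have := av213 i i.+1 k.
  have := av231 i i.+1 k; have := av321 i i.+1 k.
  have := @f_neq i i.+1; have := @f_neq i k; have := @f_neq i.+1 k.
  rewrite /= !agreeE; lia.
have alt i : i < m -> (f i < f i.+1) = odd i (+) (f 0 < f 1).
  elim: i => // i IHi im; have [_ ->] // := between i i.+2 (ltnSn _) im.
  by rewrite IHi /= ?addNb //; lia.
have main i j : i < j -> j <= m -> (f i < f j) = odd i (+) (f 0 < f 1).
  rewrite leq_eqVlt; case/predU1P => [<- | ij] jm; first exact: alt.
  by have [-> _] := between i j ij jm; apply: alt; lia.
case f01: (f 0 < f 1); [right | left] => i j ij jm; rewrite main // f01 /shape_zigzag;
  by case: odd.
Qed.

End Shapes.

(* [(true, w)] and [(false, w)] both imply the weaker of the two patterns, except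
   that only 1-23 is used for [w123]. *)
Definition forbids (l : seq gpattern) (w : word123) : bool :=
  ((true, w) \in l) || (w != w123) && ((false, w) \in l).

(** The first half feeds the forcing lemmas; the second ensures that the resulting shapes avoid
    every pattern in [l]. *)
Definition forbids_exactly (ws : seq word123) (l : seq gpattern) : bool :=
  all (forbids l) ws && all [pred p | p.2 \in ws] l.

Section Forbids.
Variables (m : nat) (f : nat -> nat) (l : seq gpattern).
Hypothesis av_l : forall p, p \in l -> avoids m f p.

Lemma forbids123 : forbids l w123 -> avoids m f p1_23.
Proof. by rewrite /forbids eqxx orbF; exact: av_l. Qed.

Lemma forbids132 : forbids l w132 -> avoids m f p1_32.
Proof. by case/orP => [/av_l | /andP[_ /av_l/avoids132]]. Qed.

Lemma forbids213 : forbids l w213 -> avoids m f p21_3.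
Proof. by case/orP => [/av_l/avoids213 | /andP[_ /av_l]]. Qed.

Lemma forbids231 : forbids l w231 -> avoids m f p23_1.
Proof. by case/orP => [/av_l/avoids231 | /andP[_ /av_l]]. Qed.

Lemma forbids312 : forbids l w312 -> avoids m f p3_12.
Proof. by case/orP => [/av_l | /andP[_ /av_l/avoids312]]. Qed.

End Forbids.

(** * Counting the avoiders for each choice of forbidden words *)

Section Cardinality.
Variables (n : nat) (P : {set gpattern}) (l : seq gpattern).
Hypotheses (n_gt1 : 1 < n) (P_l : P =i l).

Lemma card_Avoiders_swap :
  forbids_exactly [:: w123; w132; w213; w312] l -> #|Avoiders n P| = 2.
Proof.
case: n n_gt1 => // m m_gt0 /andP[/and5P[h123 h132 h213 h312 _] /allP sub].
apply: (card_Avoiders2 (@shape_dec_consistent m)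
         (@shape_swap_consistent m) (ltn0Sn 0) m_gt0).
  by rewrite /shape_dec /shape_swap.
move=> s; split=> [sh p | avP].
  rewrite P_l => /sub /= pw; case: sh => [|] sh;
    last exact: shape_swap_avoids sh pw.
  by apply: shape_dec_avoids sh _; move: pw; rewrite !inE; case/or4P=> ->; rewrite ?orbT.
have av_l p : p \in l -> avoids m (letter s) p by rewrite -P_l; exact: avP.
exact: shape_swap_forced (@letter_inj _ s)
         (forbids123 av_l h123) (forbids132 av_l h132)
         (forbids213 av_l h213) (forbids312 av_l h312).
Qed.

Lemma card_Avoiders_swap_last :
  forbids_exactly [:: w123; w132; w213; w231] l -> #|Avoiders n P| = 2.
Proof.
case: n n_gt1 => // m m_gt0 /andP[/and5P[h123 h132 h213 h231 _] /allP sub].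
(* The two shapes differ only at the pair [m.-1], [m]. *)
have lt_pred : m.-1 < m by lia.
apply: (card_Avoiders2 (@shape_dec_consistent m)
         (@shape_swap_last_consistent m) lt_pred (leqnn m)).
  by rewrite /shape_dec /shape_swap_last prednK ?eqxx.
move=> s; split=> [sh p | avP].
  rewrite P_l => /sub /= pw; case: sh => [|] sh;
    last exact: shape_swap_last_avoids sh pw.
  by apply: shape_dec_avoids sh _; move: pw; rewrite !inE; case/or4P=> ->; rewrite ?orbT.
have av_l p : p \in l -> avoids m (letter s) p by rewrite -P_l; exact: avP.
exact: shape_swap_last_forced (@letter_inj _ s)
         (forbids123 av_l h123) (forbids132 av_l h132)
         (forbids213 av_l h213) (forbids231 av_l h231).
Qed.

Lemma card_Avoiders_min_first :
  forbids_exactly [:: w123; w213; w231; w312] l -> #|Avoiders n P| = 2.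
Proof.
case: n n_gt1 => // m m_gt0 /andP[/and5P[h123 h213 h231 h312 _] /allP sub].
apply: (card_Avoiders2 (@shape_dec_consistent m)
         (@shape_min_first_consistent m) (ltn0Sn 0) m_gt0).
  by rewrite /shape_dec /shape_min_first.
move=> s; split=> [sh p | avP].
  rewrite P_l => /sub /= pw; case: sh => [|] sh;
    last exact: shape_min_first_avoids sh pw.
  by apply: shape_dec_avoids sh _; move: pw; rewrite !inE; case/or4P=> ->; rewrite ?orbT.
have av_l p : p \in l -> avoids m (letter s) p by rewrite -P_l; exact: avP.
exact: shape_min_first_forced (@letter_inj _ s)
         (forbids123 av_l h123) (forbids213 av_l h213)
         (forbids231 av_l h231) (forbids312 av_l h312).
Qed.

Lemma card_Avoiders_max_last :
  forbids_exactly [:: w123; w132; w231; w312] l -> #|Avoiders n P| = 2.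
Proof.
case: n n_gt1 => // m m_gt0 /andP[/and5P[h123 h132 h231 h312 _] /allP sub].
have lt_pred : m.-1 < m by lia.
apply: (card_Avoiders2 (@shape_dec_consistent m)
         (@shape_max_last_consistent m) lt_pred (leqnn m)).
  by rewrite /shape_dec /shape_max_last eqxx.
move=> s; split=> [sh p | avP].
  rewrite P_l => /sub /= pw; case: sh => [|] sh;
    last exact: shape_max_last_avoids sh pw.
  by apply: shape_dec_avoids sh _; move: pw; rewrite !inE; case/or4P=> ->; rewrite ?orbT.
have av_l p : p \in l -> avoids m (letter s) p by rewrite -P_l; exact: avP.
exact: shape_max_last_forced (@letter_inj _ s)
         (forbids123 av_l h123) (forbids132 av_l h132)
         (forbids231 av_l h231) (forbids312 av_l h312).
Qed.

Lemma card_Avoiders_inc :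
  forbids_exactly [:: w132; w213; w231; w312] l -> #|Avoiders n P| = 2.
Proof.
case: n n_gt1 => // m m_gt0 /andP[/and5P[h132 h213 h231 h312 _] /allP sub].
apply: (card_Avoiders2 (@shape_dec_consistent m)
         (@shape_inc_consistent m) (ltn0Sn 0) m_gt0).
  by rewrite /shape_dec /shape_inc.
move=> s; split=> [sh p | avP].
  rewrite P_l => /sub /= pw; case: sh => [|] sh;
    last exact: shape_inc_avoids sh pw.
  by apply: shape_dec_avoids sh _; move: pw; rewrite !inE; case/or4P=> ->; rewrite ?orbT.
have av_l p : p \in l -> avoids m (letter s) p by rewrite -P_l; exact: avP.
exact: shape_inc_forced (@letter_inj _ s)
         (forbids132 av_l h132) (forbids213 av_l h213)
         (forbids231 av_l h231) (forbids312 av_l h312).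
Qed.

(** In 123 and 321 the letter 2 is in the middle, so the dash cannot be moved; hence 12-3 and 32-1
    are required literally. *)
Definition forbids_zigzag : bool :=
  [&& p12_3 \in l, forbids l w213, forbids l w231, p32_1 \in l
    & all [in [:: p12_3; p2_13; p21_3; p2_31; p23_1; p32_1]] l].

Lemma card_Avoiders_zigzag : forbids_zigzag -> #|Avoiders n P| = 2.
Proof.
case: n n_gt1 => // m m_gt0 /and5P[h123 h213 h231 h321 /allP sub].
apply: (card_Avoiders2 (@shape_zigzag_consistent m true)
         (@shape_zigzag_consistent m false) (ltn0Sn 0) m_gt0).
  by [].
move=> s; split=> [sh p | avP].
  by rewrite P_l => /sub pw; case: sh => sh; apply: shape_zigzag_avoids sh pw.
have av_l p : p \in l -> avoids m (letter s) p by rewrite -P_l; exact: avP.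
exact: shape_zigzag_forced (@letter_inj _ s) (av_l _ h123) (forbids213 av_l h213)
         (forbids231 av_l h231) (av_l _ h321).
Qed.

End Cardinality.

(** The first five cases omit in turn 231, 312, 132, 213 and 123 from the five words other than 321;
    the omitted word is the one the second shape contains. Working with lists makes the test
    computable. *)
Definition two_avoiders (l : seq gpattern) : bool :=
  [|| forbids_exactly [:: w123; w132; w213; w312] l,
      forbids_exactly [:: w123; w132; w213; w231] l,
      forbids_exactly [:: w123; w213; w231; w312] l,
      forbids_exactly [:: w123; w132; w231; w312] l,
      forbids_exactly [:: w132; w213; w231; w312] l
    | forbids_zigzag l].

Lemma two_avoidersP r a b c d :
    two_avoiders [:: r; a; b; c; d] ->
  exists k : nat, forall n : nat, k <= n ->
    #|Avoiders n (r |: [set a; b; c; d])| = 2.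
Proof.
(* Two letters already separate the two shapes; with one letter they coincide. *)
move=> two; exists 2 => n n_gt1.
have P_l : r |: [set a; b; c; d] =i [:: r; a; b; c; d].
  by move=> p; rewrite !inE -!orbA.
case/or4P: two => [|||/or3P[]].
- exact: card_Avoiders_swap.
- exact: card_Avoiders_swap_last.
- exact: card_Avoiders_min_first.
- exact: card_Avoiders_max_last.
- exact: card_Avoiders_inc.
- exact: card_Avoiders_zigzag.
Qed.

(** Unfolds unions and images until each listed set is explicit, leaving one closed instance of
    [two_avoiders] per set to be computed. *)
Ltac split_family :=
  lazymatch goal with
  | |- is_true (_ || _) -> _ => case/orP; split_family
  | |- is_true (_ == _) -> _ => move/eqP->; split_family
  | |- is_true (in_mem _ _) -> _ =>
      first [case/imset2P=> ? ? + + -> | case/imsetP=> ? + ->];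
      rewrite !inE -?orbA; split_family
  | |- _ => idtac
  end.

Theorem mainTheorem14 :
  [/\ forall Q : {set gpattern}, Q \in Qs_21_3 ->
        exists k : nat, forall n : nat, k <= n -> #|Avoiders n (p21_3 |: Q)| = 2,
      forall Q : {set gpattern}, Q \in Qs_3_12 ->
        exists k : nat, forall n : nat, k <= n -> #|Avoiders n (p3_12 |: Q)| = 2,
      forall Q : {set gpattern}, Q \in Qs_23_1 ->
        exists k : nat, forall n : nat, k <= n -> #|Avoiders n (p23_1 |: Q)| = 2,
      forall Q : {set gpattern}, Q \in Qs_1_32 ->
        exists k : nat, forall n : nat, k <= n -> #|Avoiders n (p1_32 |: Q)| = 2
    & forall Q : {set gpattern}, Q \in Qs_12_3 ->
        exists k : nat, forall n : nat, k <= n -> #|Avoiders n (p12_3 |: Q)| = 2].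
Proof.
split=> Q; rewrite !inE -?orbA; split_family; apply: two_avoidersP; by vm_compute.
Qed.
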